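(* Let $n\ge 1$ and let $(a_{i_1\ldots i_n})_{i_1,\ldots,i_n\geq 0}$ be a collection of nonnegative real numbers indexed by $n$-tuples of nonnegative integers. Then there exist elements $x_1,\ldots,x_n$ in some commutative Banach algebra with $\lVert x_1^{i_1}\cdots x_n^{i_n}\rVert=a_{i_1\ldots i_n}$ for all integers $i_1,\ldots,i_n\geq 0$ if and only if $a_{0\ldots 0}=1$ and $a_{(i_1+j_1)\ldots (i_n+j_n)}\leq a_{i_1\ldots i_n}a_{j_1\ldots j_n}$ for all integers $i_1,\ldots,i_n,j_1,\ldots,j_n\geq 0$.
   Context: Banach algebras are complex and unital, with submultiplicative norm and $\lVert 1\rVert=1$; $x^0=1$. *)

(* Defs.v *)
From HB Require Import structures.
From mathcomp Require Import all_boot all_order all_algebra.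
From mathcomp Require Import complex.
From mathcomp Require Import all_classical all_reals all_analysis.

Set Implicit Arguments.
Unset Strict Implicit.
Unset Printing Implicit Defensive.

Import Order.TTheory GRing.Theory Num.Theory.
Import numFieldNormedType.Exports.

Local Open Scope ring_scope.

(* Hierarchy-Builder rejects a structure inheriting both from a ring and from
   a normed module (Num.NumDomain, which is both a ring and a normed Z-module,
   would lack a join with it).  The multiplication is therefore a separate
   operation on a completeNormedModType, and the algebraic structures are put
   on the alias [ringof A] of A, whose addition and scaling are those of A. *)

HB.mixin Record isBanachAlgebra (K : numFieldType) A
    & CompleteNormedModule K A := {
  bone : A ;
  bmul : A -> A -> A ;
  bmulA : associative bmul ;
  bmul1l : left_id bone bmul ;
  bmul1r : right_id bone bmul ;
  bmulDl : left_distributive bmul +%R ;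
  bmulDr : right_distributive bmul +%R ;
  bscaleAl : forall (c : K) (x y : A), c *: bmul x y = bmul (c *: x) y ;
  bscaleAr : forall (c : K) (x y : A), c *: bmul x y = bmul x (c *: y) ;
  bnorm1 : `|bone| = 1 :> K ;
  bnormM : forall x y : A, `|bmul x y| <= `|x| * `|y| :> K
}.

#[short(type="banachAlgType")]
HB.structure Definition BanachAlgebra (K : numFieldType) :=
  {A of CompleteNormedModule K A & isBanachAlgebra K A}.

HB.mixin Record BanachAlgebra_isCom (K : numFieldType) A
    & BanachAlgebra K A := {
  bmulC : commutative (bmul : A -> A -> A)
}.

#[short(type="comBanachAlgType")]
HB.structure Definition ComBanachAlgebra (K : numFieldType) :=
  {A of BanachAlgebra K A & BanachAlgebra_isCom K A}.

Definition ringof (K : numFieldType) (A : banachAlgType K) : Type := A.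

Section RingOf.
Variable K : numFieldType.

Section Algebra.
Variable A : banachAlgType K.

HB.instance Definition _ := GRing.Lmodule.copy (ringof A) A.

Lemma bone_neq0 : (bone : ringof A) != 0.
Proof.
apply/eqP => one0; have := @bnorm1 K A.
by rewrite one0 normr0 => /esym/eqP; rewrite oner_eq0.
Qed.

HB.instance Definition _ := GRing.Zmodule_isNzRing.Build (ringof A)
  (@bmulA K A) (@bmul1l K A) (@bmul1r K A) (@bmulDl K A) (@bmulDr K A)
  bone_neq0.

HB.instance Definition _ :=
  GRing.Lmodule_isLalgebra.Build K (ringof A) (@bscaleAl K A).

HB.instance Definition _ :=
  GRing.Lalgebra_isAlgebra.Build K (ringof A) (@bscaleAr K A).

End Algebra.

Section ComAlgebra.
Variable A : comBanachAlgType K.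

HB.instance Definition _ :=
  GRing.PzRing_hasCommutativeMul.Build (ringof A) (@bmulC K A).

End ComAlgebra.
End RingOf.

(* Main.v *)
Require Import Defs.
From HB Require Import structures.
From mathcomp Require Import all_boot all_order all_algebra.
From mathcomp Require Import complex.
From mathcomp Require Import all_classical all_reals all_analysis.
From mathcomp Require Import lra.

(** The conditions are necessary because [x^(i+j) = x^i x^j] in a commutative
algebra, the norm is submultiplicative and the unit has norm 1.

For sufficiency, give the monomials of the polynomial algebra C[X_1,..,X_n] the
weights [w i := a i], that is, put on it the seminorm [sum_i w i |f i|].  The
inequality [w (i + j) <= w i * w j] is exactly what makes this seminorm
submultiplicative ([wsum_wconv_le]), and [w 0 = 1] gives the unit norm 1.  The
weights may vanish, so it is only a seminorm; its null space is spanned by the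
monomials of weight 0, and it is an ideal because [w i = 0] forces
[w (i + j) = 0].  The Banach algebra is the completion of the quotient by this
ideal, and the [x_k] are the classes of the variables, so that the monomial of
exponent [i] has norm [w i].

This algebra is realized concretely, so that neither a quotient nor a completion
has to be formed: its elements are the families [f] of complex numbers indexed
by multi-indices that vanish where [w] does and for which the finite sums
[sum_(i in s) w i |f i|] are bounded; the norm is the supremum of these sums.
Such families form a Banach space for any index type and any nonnegative weight
([l1_complete]).  The product is the convolution, set to 0 at the multi-indices
of weight 0.  A multi-index is a sum of two others in finitely many ways only,
so the algebra laws are identities between finite sums; the resetting to 0 does
not spoil associativity, since a decomposition of a multi-index of nonzero
weight involves only multi-indices of nonzero weight
([antidiag_weight_neq0]). *)

Set Implicit Arguments.
Unset Strict Implicit.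
Unset Printing Implicit Defensive.

Import Order.TTheory GRing.Theory Num.Theory.
Import numFieldNormedType.Exports.

Local Open Scope ring_scope.
Local Open Scope complex_scope.

(** * Modulus and finite sums *)

Section Modulus.
Variable R : realType.
Implicit Types x y : R[i].

(** The norm of [R[i]] takes its values in [R[i]]; suprema need it in [R]. *)
Definition modulus x : R := complex.Re `|x|.

Lemma norm_modulus x : `|x| = (modulus x)%:C.
Proof. by []. Qed.

Lemma modulus0 : modulus 0 = 0.
Proof. by rewrite /modulus normr0. Qed.

Lemma modulus1 : modulus 1 = 1.
Proof. by rewrite /modulus normr1. Qed.

Lemma modulus_ge0 x : 0 <= modulus x.
Proof. by rewrite -lecR -norm_modulus normr_ge0. Qed.

Lemma modulusM x y : modulus (x * y) = modulus x * modulus y.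
Proof.
by apply: (@complexI R); rewrite rmorphM/= -!norm_modulus normrM.
Qed.

Lemma le_modulusD x y : modulus (x + y) <= modulus x + modulus y.
Proof. by rewrite -lecR rmorphD/= -!norm_modulus ler_normD. Qed.

Lemma modulus_eq0 x : modulus x = 0 -> x = 0.
Proof. by move=> x0; apply/eqP; rewrite -normr_eq0 norm_modulus x0. Qed.

Lemma le_modulus_sum (J : Type) (s : seq J) (F : J -> R[i]) :
  modulus (\sum_(j <- s) F j) <= \sum_(j <- s) modulus (F j).
Proof.
elim/big_ind2 : _ => [|x r y t xr yt|//]; first by rewrite modulus0.
by rewrite (le_trans (le_modulusD _ _))// lerD.
Qed.

Lemma modulus_real (c : R) : modulus c%:C = `|c|.
Proof. by rewrite /modulus normc_def/= expr0n addr0 sqrtr_sqr. Qed.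

Lemma modulus_ge_Re x : `|complex.Re x| <= modulus x.
Proof. by rewrite -lecR -norm_modulus normc_ge_Re. Qed.

Lemma modulus_ge_Im x : `|complex.Im x| <= modulus x.
Proof.
rewrite /modulus normc_def/= -sqrtr_sqr ler_sqrt ?addr_ge0 ?sqr_ge0//.
by rewrite lerDr sqr_ge0.
Qed.

Lemma modulus_le_ReIm x : modulus x <= `|complex.Re x| + `|complex.Im x|.
Proof.
rewrite {1}[x]complexE (le_trans (le_modulusD _ _))//.
rewrite modulusM !modulus_real.
suff -> : modulus 'i = 1 by rewrite mul1r.
by rewrite /modulus normc_def/= expr0n expr1n add0r sqrtr1.
Qed.

End Modulus.

Lemma ler_sum_uniq_subset (R : numDomainType) (J : eqType) (F : J -> R)
    (s t : seq J) : (forall j, 0 <= F j) -> uniq s -> uniq t ->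
  {subset s <= t} -> \sum_(j <- s) F j <= \sum_(j <- t) F j.
Proof.
move=> F0 us ut st; rewrite [leRHS](bigID (mem s))/= -[in leRHS]big_filter.
rewrite [X in _ <= X + _](perm_big s) ?lerDl ?sumr_ge0//.
apply: uniq_perm => // [|j]; first exact: filter_uniq.
by rewrite mem_filter; have [/st ->|] := boolP (j \in s).
Qed.

(** The pairs in [t] lie in the rectangle spanned by their two projections, over
which the sum of the products is a product of sums. *)
Lemma ler_sum_pairs (R : numDomainType) (I J : eqType) (F : I -> R)
    (G : J -> R) (t : seq (I * J)) :
    (forall i, 0 <= F i) -> (forall j, 0 <= G j) -> uniq t ->
  \sum_(p <- t) F p.1 * G p.2 <=
  (\sum_(i <- undup (unzip1 t)) F i) * (\sum_(j <- undup (unzip2 t)) G j).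
Proof.
move=> F0 G0 ut.
rewrite big_distrlr.
rewrite -(big_allpairs_dep (h := pair) (F := fun p => F p.1 * G p.2)).
apply: ler_sum_uniq_subset => //.
- by move=> p; rewrite mulr_ge0.
- by apply: allpairs_uniq => [||[? ?] [? ?]//]; exact: undup_uniq.
- move=> [i j] ijt; apply/allpairsP; exists (i, j); rewrite !mem_undup.
  by split=> //; [apply: (map_f fst ijt)|apply: (map_f snd ijt)].
Qed.

(** * The weighted space of absolutely summable families *)

Record weight (R : realType) (I : Type) := Weight {
  weight_fun :> I -> R ;
  weight_ge0 : forall i, 0 <= weight_fun i }.

Section WeightedSums.
Variables (R : realType) (I : choiceType) (w : weight R I).
Implicit Types (f g : I -> R[i]) (s : seq I).
Local Open Scope classical_set_scope.

Definition wsum f s : R := \sum_(i <- s) w i * modulus (f i).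

Definition wsums f : set R := [set wsum f s | s in [set s | uniq s]].

Definition wnorm f : R := sup (wsums f).

(** Families vanishing where [w] does stand for the classes of families modulo
the null space of the weighted seminorm. *)
Definition summable_pred : {pred I -> R[i]} :=
  [pred f | `[< (forall i, w i = 0 -> f i = 0) /\ has_ubound (wsums f) >]].

Lemma summableI (f : I -> R[i]) (C : R) :
    (forall i, w i = 0 -> f i = 0) -> (forall s, uniq s -> wsum f s <= C) ->
  f \in summable_pred.
Proof.
by move=> f0 fC; apply/asboolP; split=> //; exists C => _ [s us <-]; exact: fC.
Qed.

Lemma summable_supp f i : f \in summable_pred -> w i = 0 -> f i = 0.
Proof. by move=> /asboolP[+ _]; exact. Qed.

Lemma wsum_le_wnorm f s : f \in summable_pred -> uniq s -> wsum f s <= wnorm f.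
Proof. by move=> /asboolP[_ bf] us; apply: ub_le_sup => //; exists s. Qed.

Lemma wnorm_le f C : (forall s, uniq s -> wsum f s <= C) -> wnorm f <= C.
Proof.
move=> fC; apply: ge_sup => [|_ [s us <-]]; last exact: fC.
by exists (wsum f [::]), [::].
Qed.

Lemma wnorm_ge0 f : f \in summable_pred -> 0 <= wnorm f.
Proof.
move=> fl; apply: le_trans (wsum_le_wnorm (s := [::]) fl isT).
by rewrite /wsum big_nil.
Qed.

Lemma wsumD f g s : wsum (f + g) s <= wsum f s + wsum g s.
Proof.
rewrite -big_split ler_sum// => i _ /=.
by rewrite -mulrDr ler_wpM2l ?weight_ge0// le_modulusD.
Qed.

Lemma wsumZ c f s : wsum (c *: f) s = modulus c * wsum f s.
Proof.
rewrite /wsum mulr_sumr; apply: eq_bigr => i _.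
by rewrite -[(c *: f) i]/(c * f i) modulusM mulrCA.
Qed.

Lemma wsum_point f i : f \in summable_pred -> w i * modulus (f i) <= wnorm f.
Proof.
move=> fl; apply: le_trans (wsum_le_wnorm (s := [:: i]) fl isT).
by rewrite /wsum big_seq1.
Qed.

Fact summable_submod_closed : submod_closed summable_pred.
Proof.
split.
  apply: (@summableI 0 0) => // s _; rewrite /wsum big1// => i _.
  by rewrite modulus0 mulr0.
move=> c f g fl gl.
apply: (@summableI _ (modulus c * wnorm f + wnorm g)) => [i wi0|s us].
  rewrite -[(c *: f + g) i]/(c * f i + g i).
  by rewrite !summable_supp// mulr0 addr0.
rewrite (le_trans (wsumD _ _ _))// wsumZ lerD ?wsum_le_wnorm//.
by rewrite ler_wpM2l ?modulus_ge0 ?wsum_le_wnorm.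
Qed.
HB.instance Definition _ :=
  GRing.isSubmodClosed.Build R[i] (I -> R[i]) summable_pred
    summable_submod_closed.

End WeightedSums.

Record l1 (R : realType) (I : choiceType) (w : weight R I) := L1 {
  l1_fun :> I -> R[i] ;
  l1P : l1_fun \in summable_pred w }.

Section L1NormedModule.
Variables (R : realType) (I : choiceType) (w : weight R I).
Implicit Types f g : l1 w.

HB.instance Definition _ := [isSub for @l1_fun R I w].
HB.instance Definition _ := [Choice of l1 w by <:].
HB.instance Definition _ := [SubChoice_isSubLmodule of l1 w by <:].

Lemma l1_inj f g : l1_fun f = l1_fun g -> f = g.
Proof. exact: val_inj. Qed.

Let norm f : R[i] := (wnorm w f)%:C.

Let norm_triangle f g : norm (f + g) <= norm f + norm g.
Proof.
rewrite -rmorphD lecR; apply: wnorm_le => s us.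
by rewrite (le_trans (wsumD _ _ _ _))// lerD// wsum_le_wnorm ?l1P.
Qed.

(** The inequality [norm (c *: f) <= |c| * norm f] for the inverse scalar gives
the converse one. *)
Let norm_homogeneous c f : norm (c *: f) = `|c| * norm f.
Proof.
have le_normZ d (g : l1 w) : wnorm w (d *: g) <= modulus d * wnorm w g.
  apply: wnorm_le => s us.
  by rewrite wsumZ ler_wpM2l ?modulus_ge0// wsum_le_wnorm ?l1P.
rewrite norm_modulus -rmorphM; congr (_%:C); apply: le_anti.
rewrite le_normZ andTb; have [->|c0] := eqVneq c 0.
  by rewrite modulus0 mul0r wnorm_ge0 ?l1P.
have mc0 : 0 < modulus c.
  by rewrite lt0r modulus_ge0 andbT; apply: contra_neq c0 => /modulus_eq0.
have := le_normZ c^-1 (c *: f); rewrite scalerA mulVf// scale1r.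
suff -> : modulus c^-1 = (modulus c)^-1 by rewrite mulrC ler_pdivlMr// mulrC.
apply: (mulfI (lt0r_neq0 mc0)).
by rewrite -modulusM divff// modulus1 divff ?lt0r_neq0.
Qed.

Let norm_definite f : norm f = 0 -> f = 0.
Proof.
move=> /complexI f0; apply: l1_inj; apply: funext => i; apply: modulus_eq0.
have [wi0|wi_neq0] := eqVneq (w i) 0.
  by rewrite (summable_supp (l1P f) wi0) modulus0.
apply: (mulfI wi_neq0); apply: le_anti.
rewrite mulr0 mulr_ge0 ?weight_ge0 ?modulus_ge0// andbT.
by rewrite -f0 wsum_point ?l1P.
Qed.

HB.instance Definition _ := Lmodule_isNormed.Build R[i] (l1 w)
  norm_triangle norm_homogeneous norm_definite.

Lemma l1_normE f : `|f| = (wnorm w f)%:C.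
Proof. by []. Qed.

End L1NormedModule.

Section L1Complete.
Variables (R : realType) (I : choiceType) (w : weight R I).
Local Open Scope classical_set_scope.

Lemma l1_ballE (f g : l1 w) (e : R) :
  ball f (e%:C : R[i]) g = (wnorm w (f - g) < e) :> Prop.
Proof. by rewrite -ball_normE -ltcR. Qed.

(** A map that does not increase distances sends a Cauchy filter to a Cauchy
filter of reals, which converges.  It will be applied to the real and imaginary
parts of the weighted coordinates. *)
Lemma l1_pointwise_cauchy (F : set_system (l1 w)) (u : l1 w -> R) :
    ProperFilter F -> cauchy F ->
    (forall f g, `|u f - u g| <= wnorm w (f - g)) ->
  u @ F --> lim (u @ F).
Proof.
move=> FF /cauchyP Fc uL; apply: cauchy_cvg; apply: cauchy_exP => e e0.
have eC0 : 0 < e%:C by rewrite ltcR.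
have [h Fh] := Fc _ eC0; exists (u h).
apply: (@filterS _ F _ (ball h e%:C)) Fh => f; rewrite l1_ballE => hf.
by rewrite -ball_normE /=; exact: le_lt_trans (uL _ _) hf.
Qed.

(** The norm controls the weighted coordinates, so these converge along a Cauchy
filter; where the weight is 0, the coordinates are 0. *)
Lemma l1_cauchy_limit (F : set_system (l1 w)) :
    ProperFilter F -> cauchy F ->
  exists l : I -> R[i], (forall i, w i = 0 -> l i = 0) /\
    forall i e, 0 < e ->
      \forall f \near F, w i * modulus (l1_fun f i - l i) < e.
Proof.
move=> FF Fc.
pose lm (P : R[i] -> R) i := lim ((fun f : l1 w => w i * P (f i)) @ F).
have Lip (P : R[i] -> R) (PB : {morph P : x y / x - y}) :
    (forall x, `|P x| <= modulus x) ->
  forall i, (fun f : l1 w => w i * P (f i)) @ F --> lm P i.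
  move=> Pm i; apply: l1_pointwise_cauchy => // f g.
  rewrite -mulrBr -PB normrM ger0_norm ?weight_ge0//.
  apply: le_trans (wsum_point i (l1P (f - g))).
  by rewrite ler_wpM2l ?weight_ge0.
have LRe := Lip _ (@raddfB _ _ (@complex.Re R)) (@modulus_ge_Re R).
have LIm := Lip _ (@raddfB _ _ (@complex.Im R)) (@modulus_ge_Im R).
set lRe := lm _ in LRe; set lIm := lm _ in LIm.
(* Division by 0 yields 0, so this limit vanishes where the weight does. *)
exists (fun i => (lRe i / w i) +i* (lIm i / w i)); split=> [i ->|i e e0].
  by rewrite invr0 !mulr0.
have [wi0|wi_neq0] := eqVneq (w i) 0.
  by near=> f; rewrite wi0 mul0r.
have e20 : 0 < e / 2 by lra.
have /fcvgrPdist_lt/(_ _ e20) nRe := LRe i.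
have /fcvgrPdist_lt/(_ _ e20) nIm := LIm i.
near=> f.
have lt1 : `|lRe i - w i * complex.Re (f i)| < e / 2.
  by near: f; exact: nRe.
have lt2 : `|lIm i - w i * complex.Im (f i)| < e / 2.
  by near: f; exact: nIm.
rewrite [e]splitr (le_lt_trans _ (ltrD lt1 lt2))//.
rewrite (le_trans (ler_wpM2l (weight_ge0 _ _) (modulus_le_ReIm _)))//.
rewrite mulrDr !raddfB/= -!(distrC (w i * _)).
rewrite -[X in X * _ + _]ger0_norm ?weight_ge0//.
rewrite -[X in _ + X * _]ger0_norm ?weight_ge0//.
by rewrite -!normrM !mulrBr ![_ * (_ / _)]mulrC !divfK.
Unshelve. all: by end_near. Qed.

Lemma near_wsum_lt (F : set_system (l1 w)) (l : I -> R[i]) : Filter F ->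
    (forall i e, 0 < e ->
      \forall f \near F, w i * modulus (l1_fun f i - l i) < e) ->
  forall s e, 0 < e -> \forall f \near F, wsum w (l1_fun f - l) s < e.
Proof.
move=> FF Fl; elim=> [|i s IHs] e e0.
  by near=> f; rewrite /wsum big_nil.
have e20 : 0 < e / 2 by lra.
have n1 := Fl i _ e20; have n2 := IHs _ e20.
near=> f; rewrite /wsum big_cons [e]splitr ltrD//.
  by near: f; exact: n1.
by near: f; exact: n2.
Unshelve. all: by end_near. Qed.

(** When a ball of radius [e] belongs to the filter, all finite weighted sums of
the difference of two of its elements are below [2 e].  Moving the second one
along the filter to the coordinatewise limit [l] gives a bound by [3 e] that
does not depend on the finite set: hence [l] is summable and is the limit in
norm. *)
Lemma l1_complete (F : set_system (l1 w)) :
  ProperFilter F -> cauchy F -> cvg F.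
Proof.
move=> FF Fc; have [l [l0 Fl]] := l1_cauchy_limit FF Fc.
have close e (h f : l1 w) s : 0 < e -> F (ball h e%:C) -> ball h e%:C f ->
    uniq s -> wsum w (l1_fun f - l) s <= 3 * e.
  move=> e0 Fh hf us.
  have [g [gh gl]] := filter_ex (filterI Fh (near_wsum_lt FF Fl s e0)).
  have -> : l1_fun f - l = val (f - g) + (l1_fun g - l).
    by rewrite raddfB/= addrA subrK.
  rewrite (le_trans (wsumD _ _ _ _))//.
  have fg : wnorm w (f - g) < e + e.
    rewrite -l1_ballE rmorphD/=.
    by apply: ball_triangle gh; exact: ball_sym.
  have := wsum_le_wnorm (l1P (f - g)) us.
  by move: gl fg => /= gl fg fgs; lra.
have /cauchyP Fce := Fc.
(* [l] differs from some [h] in the space by a summable family. *)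
have ll1 : l \in summable_pred w.
  have [|h Fh] := Fce 1; first by [].
  have hh : ball h (1%:C : R[i]) h by apply: ballxx.
  have -> : l = l1_fun h - (l1_fun h - l) by rewrite subKr.
  rewrite rpredB ?l1P//; apply: (@summableI _ _ _ _ (3 * 1)) => [i wi0|s us].
    by rewrite -[LHS]/(h i - l i) l0// (summable_supp (l1P h) wi0) subr0.
  exact: (close 1 h h).
apply/cvg_ex; exists (L1 ll1); apply/fcvgrPdist_lt => e e0.
have [r r0 re] : exists2 r : R, 0 < r & e = r%:C.
  exists (complex.Re e); move: e0; rewrite ltcE/= => /andP[/eqP e1 //].
  by rewrite [LHS]complexE e1/= mulr0 addr0.
have r40 : 0 < r / 4 by lra.
have [|h Fh] := Fce (r / 4)%:C; first by rewrite ltcR.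
apply: filterS (Fh) => f hf; rewrite re distrC l1_normE ltcR.
apply: (@le_lt_trans _ _ (3 * (r / 4))); last by lra.
apply: wnorm_le => s us.
exact: (close _ h).
Qed.

HB.instance Definition _ := Uniform_isComplete.Build (l1 w) l1_complete.

End L1Complete.

(** * Antidiagonals of multi-indices *)

Lemma sum_delta_seq (V : nmodType) (J : eqType) (s : seq J) (a : J)
    (F : J -> V) : uniq s ->
  \sum_(j <- s) (if j == a then F j else 0) = if a \in s then F a else 0.
Proof.
move=> us; have [ais|ans] := ifPn.
  rewrite (bigD1_seq a)//= eqxx big1 ?addr0// => j ja.
  by rewrite (negPf ja).
rewrite big_seq big1// => j js; case: eqP => // ja.
by rewrite -ja js in ans.
Qed.

Section Antidiagonal.
Variable n : nat.
Local Notation M := {ffun 'I_n -> nat}.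
Implicit Types (m : M) (p : M * M).

(** The decompositions of [m] as an ordered sum of two multi-indices.  They are
sought in a box whose side is the degree of [m], which bounds every entry. *)
Definition antidiag m : seq (M * M) :=
  let box : seq M :=
    [seq [ffun k => nat_of_ord (u k)]
    | u : {ffun 'I_n -> 'I_(\sum_k m k).+1}] in
  [seq p <- [seq (i, j) | i <- box, j <- box] | p.1 + p.2 == m].

Lemma antidiag_uniq m : uniq (antidiag m).
Proof.
rewrite filter_uniq// allpairs_uniq// => [||[? ?] [? ?]//].
  all: rewrite map_inj_uniq ?enum_uniq// => u v /ffunP uv.
  all: by apply/ffunP => k; apply: val_inj; have := uv k; rewrite !ffunE.
Qed.

Lemma mem_antidiag m p : (p \in antidiag m) = (p.1 + p.2 == m).
Proof.
rewrite mem_filter; have [pm|//] := eqP; rewrite andTb.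
have in_box (i : M) : (forall k, i k <= m k)%N ->
    i \in [seq ([ffun k => nat_of_ord (u k)] : M)
          | u : {ffun 'I_n -> 'I_(\sum_k m k).+1}].
  move=> im; apply/mapP; exists [ffun k => inord (i k)].
    by rewrite mem_enum.
  apply/ffunP => k; rewrite !ffunE inordK// ltnS (leq_trans (im k))//.
  by rewrite (bigD1 k)//= leq_addr.
apply/allpairsP; exists p; split; rewrite -?surjective_pairing//.
  all: by apply: in_box => k; rewrite -pm ffunE ?leq_addr ?leq_addl.
Qed.

Lemma antidiag_swap m :
  perm_eq [seq (p.2, p.1) | p <- antidiag m] (antidiag m).
Proof.
apply: uniq_perm (antidiag_uniq m) _ => [|p].
  by rewrite map_inj_uniq ?antidiag_uniq// => -[? ?] [? ?] [-> ->].
rewrite mem_antidiag; apply/mapP/idP => [[q + ->]|pm].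
  by rewrite mem_antidiag addrC.
by exists (p.2, p.1); rewrite ?mem_antidiag 1?addrC//=; case: p pm.
Qed.

(** Both sides sum over the decompositions of [m] as a sum of three
multi-indices. *)
Lemma antidiag_assoc (V : nmodType) (F : M -> M -> M -> V) m :
  \sum_(p <- antidiag m) \sum_(q <- antidiag p.1) F q.1 q.2 p.2 =
  \sum_(p <- antidiag m) \sum_(q <- antidiag p.2) F p.1 q.1 q.2.
Proof.
pose F3 (t : M * M * M) := F t.1.1 t.1.2 t.2.
pose hl (p q : M * M) := (q.1, q.2, p.2).
pose hr (p q : M * M) := (p.1, q.1, q.2).
transitivity
  (\sum_(t <- [seq hl p q | p <- antidiag m, q <- antidiag p.1]) F3 t).
  by rewrite big_allpairs_dep.
transitivity
  (\sum_(t <- [seq hr p q | p <- antidiag m, q <- antidiag p.2]) F3 t);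
  last by rewrite big_allpairs_dep.
apply: perm_big; apply: uniq_perm => [||[[i j] k]].
- apply: allpairs_uniq_dep => [|p _|]; rewrite ?antidiag_uniq//.
  move=> _ _ /allpairsPdep[[x y] [q [_ + ->]]]
            /allpairsPdep[[x' y'] [q' [_ + ->]]].
  rewrite !mem_antidiag/= => /eqP qx /eqP qx' [].
  by case: q q' qx qx' => [? ?] [? ?] /= <- <- -> -> ->.
- apply: allpairs_uniq_dep => [|p _|]; rewrite ?antidiag_uniq//.
  move=> _ _ /allpairsPdep[[x y] [q [_ + ->]]]
            /allpairsPdep[[x' y'] [q' [_ + ->]]].
  rewrite !mem_antidiag/= => /eqP qx /eqP qx' [].
  by case: q q' qx qx' => [? ?] [? ?] /= <- <- -> -> ->.
- apply/allpairsPdep/allpairsPdep => -[p [q]]; rewrite !mem_antidiag.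
    move=> [/eqP pm /eqP qp] [-> -> ->]; exists (q.1, q.2 + p.2), (q.2, p.2).
    by rewrite !mem_antidiag /= addrA qp pm !eqxx.
  move=> [/eqP pm /eqP qp] [-> -> ->]; exists (p.1 + q.1, q.2), (p.1, q.1).
  by rewrite !mem_antidiag /= -addrA qp pm !eqxx.
Qed.

End Antidiagonal.

(** * The weighted convolution algebra *)

Record algebra_weight (R : realType) (n : nat) := AlgebraWeight {
  base_weight :> weight R {ffun 'I_n -> nat} ;
  weight0 : base_weight 0 = 1 ;
  weightD : forall i j,
    base_weight (i + j) <= base_weight i * base_weight j }.

Section Convolution.
Variables (R : realType) (n : nat) (w : algebra_weight R n).
Local Notation M := {ffun 'I_n -> nat}.
Implicit Types (f g h : M -> R[i]) (i j m : M) (p : M * M).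

(** By submultiplicativity, the multi-indices of weight 0 absorb addition. *)
Lemma antidiag_weight_neq0 m p : w m != 0 -> p \in antidiag m ->
  (w p.1 != 0) && (w p.2 != 0).
Proof.
rewrite mem_antidiag => + /eqP pm; rewrite -pm -negb_or -mulf_eq0.
apply: contra_neq => w0.
by apply: le_anti; rewrite weight_ge0 -w0 weightD.
Qed.

(** The reset to 0 projects the convolution back onto the families that vanish
where the weight does. *)
Definition wconv f g m : R[i] :=
  if w m == 0 then 0 else \sum_(p <- antidiag m) f p.1 * g p.2.

Lemma wconvC f g : wconv f g = wconv g f.
Proof.
apply: funext => m; rewrite /wconv; case: ifP => // _.
rewrite -[LHS](perm_big _ (antidiag_swap m)) big_map.
by apply: eq_bigr => p _; rewrite mulrC.
Qed.

Lemma wconvA f g h : wconv f (wconv g h) = wconv (wconv f g) h.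
Proof.
apply: funext => m; rewrite /wconv; case: ifPn => // wm.
transitivity (\sum_(p <- antidiag m) \sum_(q <- antidiag p.2)
                f p.1 * g q.1 * h q.2).
  apply: eq_big_seq => p /(antidiag_weight_neq0 wm)/andP[_ /negPf->].
  by rewrite mulr_sumr; apply: eq_bigr => q _; rewrite mulrA.
rewrite -(antidiag_assoc (fun i j k => f i * g j * h k)).
apply: eq_big_seq => p /(antidiag_weight_neq0 wm)/andP[/negPf-> _].
by rewrite mulr_suml.
Qed.

Lemma wconvDl f g h : wconv (f + g) h = wconv f h + wconv g h.
Proof.
apply: funext => m; rewrite -[RHS]/(wconv f h m + wconv g h m) /wconv.
case: ifP => _; first by rewrite addr0.
by rewrite -big_split; apply: eq_bigr => p _; exact: mulrDl.
Qed.

Lemma wconvZl c f g : wconv (c *: f) g = c *: wconv f g.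
Proof.
apply: funext => m; rewrite -[RHS]/(c * wconv f g m) /wconv.
case: ifP => _; first by rewrite mulr0.
by rewrite mulr_sumr; apply: eq_bigr => p _; rewrite mulrA.
Qed.

(** Expanding the convolution over the antidiagonals and using
[w (i + j) <= w i * w j] bounds the sum by one over distinct pairs [(i, j)] of
terms [(w i |f i|) * (w j |g j|)]. *)
Lemma wsum_wconv_le f g (s : seq M) :
    f \in summable_pred w -> g \in summable_pred w -> uniq s ->
  wsum w (wconv f g) s <= wnorm w f * wnorm w g.
Proof.
move=> fl gl us.
pose F i := w i * modulus (f i); pose G j := w j * modulus (g j).
have F0 i : 0 <= F i by rewrite mulr_ge0 ?weight_ge0 ?modulus_ge0.
have G0 i : 0 <= G i by rewrite mulr_ge0 ?weight_ge0 ?modulus_ge0.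
pose t := [seq p | m <- s, p <- antidiag m].
have ut : uniq t.
  apply: allpairs_uniq_dep => // [m _|]; first exact: antidiag_uniq.
  move=> _ _ /allpairsPdep[m [p [_ + ->]]] /allpairsPdep[m' [p' [_ + ->]]].
  by rewrite !mem_antidiag/= => /eqP <- /eqP <- ->.
apply: (@le_trans _ _ (\sum_(p <- t) F p.1 * G p.2)).
  rewrite big_allpairs_dep ler_sum// => m _.
  rewrite /wconv; case: ifP => _.
    by rewrite modulus0 mulr0 sumr_ge0// => p _; rewrite mulr_ge0.
  rewrite (le_trans (ler_wpM2l (weight_ge0 _ _) (le_modulus_sum _ _)))//.
  rewrite mulr_sumr big_seq [leRHS]big_seq ler_sum// => p.
  rewrite mem_antidiag => /eqP <-; rewrite modulusM mulrACA.
  by rewrite ler_wpM2r ?weightD// mulr_ge0 ?modulus_ge0.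
apply: le_trans (ler_sum_pairs F0 G0 ut) _.
apply: ler_pM; rewrite ?sumr_ge0//.
  exact: wsum_le_wnorm (undup_uniq _).
exact: wsum_le_wnorm (undup_uniq _).
Qed.

Lemma wconv_summable f g : f \in summable_pred w -> g \in summable_pred w ->
  wconv f g \in summable_pred w.
Proof.
move=> fl gl; apply: (@summableI _ _ _ _ (wnorm w f * wnorm w g)).
  by move=> m wm; rewrite /wconv wm eqxx.
by move=> s; exact: wsum_wconv_le.
Qed.

(** Monomials of weight 0 are in the null space of the seminorm: their class is
represented by the zero family. *)
Definition monomial_fun i m : R[i] :=
  if m == i then (w i != 0)%:R else 0.

Lemma wsum_monomial i (s : seq M) : uniq s ->
  wsum w (monomial_fun i) s = if i \in s then w i else 0.
Proof.
move=> us; rewrite -(sum_delta_seq i _ us); apply: eq_bigr => m _.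
rewrite /monomial_fun; case: eqP => [->|_]; last by rewrite modulus0 mulr0.
by case: eqVneq => [->|_]; rewrite ?mul0r// modulus1 mulr1.
Qed.

Lemma monomial_summable i : monomial_fun i \in summable_pred w.
Proof.
apply: (@summableI _ _ _ _ (w i)) => [m wm|s us].
  by rewrite /monomial_fun; case: eqP => // <-; rewrite wm eqxx.
by rewrite wsum_monomial//; case: ifP => // _; exact: weight_ge0.
Qed.

Lemma wnorm_monomial i : wnorm w (monomial_fun i) = w i.
Proof.
apply: le_anti; apply/andP; split.
  apply: wnorm_le => s us; rewrite wsum_monomial//.
  by case: ifP => // _; exact: weight_ge0.
apply: le_trans (wsum_le_wnorm (s := [:: i]) (monomial_summable i) isT).
by rewrite wsum_monomial// mem_head.
Qed.

Lemma wconv_monomial i j :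
  wconv (monomial_fun i) (monomial_fun j) = monomial_fun (i + j).
Proof.
apply: funext => m; rewrite /wconv; have [wm|wm] := ifPn.
  by rewrite /monomial_fun; case: eqP => // <-; rewrite wm.
(* Only the decomposition [(i, j)] contributes to the sum. *)
under eq_bigr => p _.
  rewrite (_ : _ * _ = if p == (i, j)
    then monomial_fun i p.1 * monomial_fun j p.2 else 0); first over.
  rewrite /monomial_fun -pair_eqE /pair_eq/=.
  by case: (p.1 == i); case: (p.2 == j); rewrite ?mulr0 ?mul0r.
rewrite sum_delta_seq ?antidiag_uniq// mem_antidiag/= /monomial_fun !eqxx.
rewrite eq_sym; case: eqP => // mij.
have := @antidiag_weight_neq0 m (i, j) wm; rewrite mem_antidiag mij eqxx.
by move=> /(_ isT)/andP[/= -> ->]; rewrite -mij wm mulr1.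
Qed.

Lemma wconv1l f : f \in summable_pred w -> wconv (monomial_fun 0) f = f.
Proof.
move=> fl; apply: funext => m; rewrite /wconv; have [/eqP wm|wm] := ifPn.
  by rewrite (summable_supp fl wm).
transitivity (\sum_(p <- antidiag m) if p == (0, m) then f p.2 else 0).
  apply: eq_big_seq => p; rewrite mem_antidiag => /eqP <-.
  rewrite /monomial_fun weight0 oner_eq0 -pair_eqE /pair_eq/=.
  by case: eqP => [->|_]; rewrite ?mul0r// add0r eqxx mul1r.
by rewrite sum_delta_seq ?antidiag_uniq// mem_antidiag/= add0r eqxx.
Qed.

End Convolution.

(** An alias of [l1 w], to carry the product: [l1] also takes weights that are
not submultiplicative. *)
Definition weighted_algebra (R : realType) (n : nat) (w : algebra_weight R n) :
  Type := l1 w.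

Section WeightedAlgebra.
Variables (R : realType) (n : nat) (w : algebra_weight R n).
Local Notation M := {ffun 'I_n -> nat}.
Local Notation A := (weighted_algebra w).
Implicit Types f g h : A.

HB.instance Definition _ := CompleteNormedModule.copy A (l1 w).

Definition l1_mul f g : A := L1 (wconv_summable (l1P f) (l1P g)).

Definition monomial (i : M) : A := L1 (monomial_summable w i).

Let mulC : commutative l1_mul.
Proof. by move=> f g; apply: l1_inj; exact: wconvC. Qed.

Let mulA : associative l1_mul.
Proof. by move=> f g h; apply: l1_inj; exact: wconvA. Qed.

Let mul1l : left_id (monomial 0) l1_mul.
Proof. by move=> f; apply: l1_inj; exact: wconv1l (l1P f). Qed.

Let mul1r : right_id (monomial 0) l1_mul.
Proof. by move=> f; rewrite mulC. Qed.

Let mulDl : left_distributive l1_mul +%R.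
Proof. by move=> f g h; apply: l1_inj; exact: wconvDl. Qed.

Let mulDr : right_distributive l1_mul +%R.
Proof. by move=> f g h; rewrite mulC mulDl !(mulC _ f). Qed.

Let mulZl (c : R[i]) f g : c *: l1_mul f g = l1_mul (c *: f) g.
Proof. by apply: l1_inj; rewrite /= wconvZl. Qed.

Let mulZr (c : R[i]) f g : c *: l1_mul f g = l1_mul f (c *: g).
Proof. by rewrite mulC mulZl mulC. Qed.

Lemma norm_monomial i : `|monomial i| = (w i)%:C.
Proof. by rewrite [LHS]l1_normE wnorm_monomial. Qed.

Let norm1 : `|monomial 0| = 1 :> R[i].
Proof. by rewrite norm_monomial weight0. Qed.

Let norm_mul f g : `|l1_mul f g| <= `|f| * `|g| :> R[i].
Proof.
rewrite !l1_normE -rmorphM lecR; apply: wnorm_le => s us.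
by apply: wsum_wconv_le; rewrite ?l1P.
Qed.

HB.instance Definition _ := isBanachAlgebra.Build R[i] A
  mulA mul1l mul1r mulDl mulDr mulZl mulZr norm1 norm_mul.
HB.instance Definition _ := BanachAlgebra_isCom.Build R[i] A mulC.

Lemma monomialD i j :
  monomial (i + j) = (monomial i : ringof A) * (monomial j : ringof A).
Proof. by apply: l1_inj; rewrite /= wconv_monomial. Qed.

Lemma monomialMn i k : monomial (i *+ k) = (monomial i : ringof A) ^+ k.
Proof. by elim: k => [//|k IHk]; rewrite mulrS exprS monomialD IHk. Qed.

Lemma monomial_sum (J : Type) (s : seq J) (F : J -> M) :
  monomial (\sum_(k <- s) F k) = \prod_(k <- s) (monomial (F k) : ringof A).
Proof.
by elim: s => [|k s IHs]; rewrite ?big_nil// !big_cons monomialD IHs.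
Qed.

Definition unit_index (k : 'I_n) : M := [ffun l => (l == k) : nat].

Lemma index_decomp (i : M) : i = \sum_(k < n) unit_index k *+ i k.
Proof.
apply/ffunP => l; rewrite sum_ffunE (bigD1 l)//= big1 => [|k kl].
  by rewrite ffunMnE ffunE eqxx addr0 natn.
by rewrite ffunMnE ffunE eq_sym (negPf kl) mul0rn.
Qed.

Lemma norm_prod_monomial (i : M) :
  `|(\prod_(k < n) (monomial (unit_index k) : ringof A) ^+ i k : ringof A)
    : A| = (w i)%:C.
Proof.
rewrite -norm_monomial [in RHS](index_decomp i) monomial_sum.
by under [in RHS]eq_bigr do rewrite monomialMn.
Qed.

End WeightedAlgebra.

(** * Norms of monomials *)

Lemma norm_monomials_submul (R : realType) (n : nat) (A : comBanachAlgType R[i])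
    (x : 'I_n -> ringof A) (a : {ffun 'I_n -> nat} -> R) :
    (forall i : {ffun 'I_n -> nat},
      `|(\prod_(k < n) x k ^+ i k : ringof A) : A| = (a i)%:C) ->
  a [ffun => 0%N] = 1 /\
  forall i j : {ffun 'I_n -> nat}, a [ffun k => (i k + j k)%N] <= a i * a j.
Proof.
move=> xa; split=> [|i j].
  apply: (@complexI R); rewrite -xa big1 => [|k _]; last by rewrite ffunE.
  exact: bnorm1.
rewrite -lecR rmorphM/= -!xa.
under eq_bigr do rewrite ffunE exprD.
rewrite big_split; exact: bnormM.
Qed.

Theorem lemma1p4 (R : realType) (n : nat) (n_ge1 : (1 <= n)%N)
    (a : {ffun 'I_n -> nat} -> R) (a_ge0 : forall i, 0 <= a i) :
  (exists (A : comBanachAlgType R[i]) (x : 'I_n -> ringof A),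
      forall i : {ffun 'I_n -> nat},
        `|(\prod_(k < n) x k ^+ i k : ringof A) : A| = (a i)%:C) <->
  (a [ffun => 0%N] = 1 /\
   forall i j : {ffun 'I_n -> nat},
     a [ffun k => (i k + j k)%N] <= a i * a j).
Proof.
split=> [[A [x]]|[a0 aD]]; first exact: norm_monomials_submul.
have a0' : Weight a_ge0 0 = 1.
  by rewrite -[RHS]a0 /=; congr a; apply/ffunP => k; rewrite !ffunE.
have aD' i j : Weight a_ge0 (i + j) <= Weight a_ge0 i * Weight a_ge0 j.
  rewrite /=; apply: le_trans (aD i j); rewrite le_eqVlt; apply/orP; left.
  by apply/eqP; congr a; apply/ffunP => k; rewrite !ffunE.
pose w := AlgebraWeight a0' aD'.
exists (weighted_algebra w : comBanachAlgType R[i]).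
by exists (fun k => monomial w (unit_index k)) => i; exact: norm_prod_monomial.
Qed.
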